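(* Let $n$ and $m$ be positive integers with $m\geq n+1$, let $P=(x_1,y_1)\cdots(x_{n+1},y_{n+1})$ be an $(n,m)$-lattice path, and let $\Theta=\Theta_P:\{1,\ldots,m\}\to\mathcal{PL}(P)$ be as defined in the context. Then $PNPL(\Theta(r))=r-1$ for every $r\in\{1,\ldots,m\}$.
   Context: An $(n,m)$-lattice path is a sequence $Q=(u_1,v_1)\cdots(u_{n+1},v_{n+1})$ of vectors in $\mathbb{Z}^2$ such that $1-n\leq v_i\leq 1$, $\sum_i v_i=1$, $1\leq u_i\leq m-1$, $\sum_i u_i=m$. For such $Q$, $NP(Q)=\{i\in\{1,\ldots,n+1\}\mid \sum_{k=1}^{i}v_k\leq 0\}$ and $NPL(Q)=\sum_{i\in NP(Q)}u_i$. A pointed $(n,m)$-lattice path is a pair $\dot{Q}=[Q;j]$ with $0\leq j\leq u_{n+1}-1$, and its pointed non-positive length is $PNPL(\dot{Q})=NPL(Q)+j$. For $P$ as in the claim and $i\in\{1,\ldots,n+1\}$, let $P_i=(x_{i+1},y_{i+1})\cdots(x_{n+1},y_{n+1})(x_1,y_1)\cdots(x_i,y_i)$ (so $P_{n+1}=P$), and let $\dot{P}(i;j)=[P_i;j]$ for $0\leq j\leq x_i-1$; $\mathcal{PL}(P)=\{\dot{P}(i;j)\mid i\in\{1,\ldots,n+1\},\ 0\leq j\leq x_i-1\}$ (it has $m$ elements, one for each such pair $(i,j)$). Let $s_i=\sum_{k=1}^{i}y_k$. Define a linear order $<_P$ on $\{1,\ldots,n+1\}$ by: $i<_P j$ iff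 either $s_i<s_j$, or $s_i=s_j$ and $i>j$. Define a linear order $\prec_P$ on $\mathcal{PL}(P)$ by: $\dot{P}(i_1;j_1)\prec_P\dot{P}(i_2;j_2)$ iff either $i_1<_P i_2$, or $i_1=i_2$ and $j_1<j_2$. Let $\Theta_P(r)$ be the $r$-th element of $\mathcal{PL}(P)$ in increasing $\prec_P$-order, for $r=1,\ldots,m$. *)

(* Defs.v *)
From mathcomp Require Import all_boot all_order all_algebra.

Set Implicit Arguments.
Unset Strict Implicit.
Unset Printing Implicit Defensive.

Import Order.TTheory GRing.Theory Num.Theory.
Local Open Scope ring_scope.

(* Indices of steps are natural numbers running from 1 to n.+1; the values of
   ustep and vstep at other indices are never used. *)

Definition ustep (n : nat) (Q : (n.+1).-tuple (int * int)) (i : nat) : int :=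
  (nth (0, 0) Q i.-1).1.

Definition vstep (n : nat) (Q : (n.+1).-tuple (int * int)) (i : nat) : int :=
  (nth (0, 0) Q i.-1).2.

Definition lattice_path (n m : nat) (Q : (n.+1).-tuple (int * int)) : Prop :=
  [/\ forall i : nat, (1 <= i <= n.+1)%N -> 1 - n%:Z <= vstep Q i <= 1,
      \sum_(1 <= i < n.+2) vstep Q i = 1,
      forall i : nat, (1 <= i <= n.+1)%N -> 1 <= ustep Q i <= m%:Z - 1
    & \sum_(1 <= i < n.+2) ustep Q i = m%:Z].

Definition height (n : nat) (Q : (n.+1).-tuple (int * int)) (i : nat) : int :=
  \sum_(1 <= k < i.+1) vstep Q k.

Definition NP (n : nat) (Q : (n.+1).-tuple (int * int)) : seq nat :=
  [seq i <- iota 1 n.+1 | height Q i <= 0].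

Definition NPL (n : nat) (Q : (n.+1).-tuple (int * int)) : int :=
  \sum_(i <- NP Q) ustep Q i.

(* The pair (Q, j) stands for [Q; j]. The condition 0 <= j <= u_{n+1} - 1 is
   imposed on the elements of PL below: the last step of rot i P is the i-th
   step of P. *)
Definition pointed (n : nat) : eqType := ((n.+1).-tuple (int * int) * nat)%type.

Definition PNPL (n : nat) (A : pointed n) : int := NPL A.1 + A.2%:Z.

Definition dotP (n : nat) (P : (n.+1).-tuple (int * int)) (a : nat * nat) :
    pointed n :=
  ([tuple of rot a.1 P], a.2).

(* The pairs (i, j) with 1 <= i <= n+1 and 0 <= j <= x_i - 1. On a lattice
   path x_i >= 1, so the absolute value only serves as a cast to nat. *)
Definition PL_index (n : nat) (P : (n.+1).-tuple (int * int)) :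
    seq (nat * nat) :=
  [seq (i, j) | i <- iota 1 n.+1, j <- iota 0 `|ustep P i|%N].

Definition PL (n : nat) (P : (n.+1).-tuple (int * int)) : seq (pointed n) :=
  undup [seq dotP P a | a <- PL_index P].

Definition ltP_index (n : nat) (P : (n.+1).-tuple (int * int)) (i j : nat) :
    bool :=
  (height P i < height P j) || ((height P i == height P j) && (j < i)%N).

Definition prec (n : nat) (P : (n.+1).-tuple (int * int)) (A B : pointed n) :
    bool :=
  has (fun a => has (fun b =>
    [&& A == dotP P a, B == dotP P b
      & ltP_index P a.1 b.1 || ((a.1 == b.1) && (a.2 < b.2)%N)])
    (PL_index P)) (PL_index P).

(* The r-th element of PL P, counting from 1. The sorting relation is the
   reflexive closure of prec; the default value (P, 0) is returned only for r
   larger than the number of elements of PL P. *)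
Definition Theta (n : nat) (P : (n.+1).-tuple (int * int)) (r : nat) :
    pointed n :=
  nth (P, 0%N) (sort (fun A B => (A == B) || prec P A B) (PL P)) r.-1.

(* Main.v *)
(** Compare the steps of [P_i] with those of [P]. A step [k > i] of [P] occurs in
    [P_i] before the wrap-around, at height [s_k - s_i]; a step [k <= i] occurs
    after it, at height [s_k - s_i + 1]. In both cases this height is at most [0]
    exactly when [k <_P i]. Hence the pointed non-positive length of [[P_i; j]]
    is [j] plus the sum of the [x_k] with [k <_P i]. As [j < x_i], this strictly
    increases along the order on pairs [(i, j)], so it takes [m] distinct values,
    all of them in [0, m), and the [r]-th one is [r - 1]. *)
Require Import Defs.
From mathcomp Require Import all_boot all_order all_algebra.
From mathcomp Require Import zify.

Set Implicit Arguments.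
Unset Strict Implicit.
Unset Printing Implicit Defensive.

Import Order.TTheory GRing.Theory Num.Theory.
Local Open Scope ring_scope.

Lemma nth_rot_before_wrap n (P : (n.+1).-tuple (int * int)) i k :
  (1 <= k)%N -> (i + k <= n.+1)%N ->
  nth (0, 0) (rot i P) k.-1 = nth (0, 0) P (i + k).-1.
Proof.
move=> k_gt0 le_ik; rewrite /rot nth_cat size_drop size_tuple.
have -> : (k.-1 < n.+1 - i)%N by lia.
by rewrite nth_drop; congr nth; lia.
Qed.

Lemma nth_rot_after_wrap n (P : (n.+1).-tuple (int * int)) i l :
  (1 <= l <= i)%N -> (i <= n.+1)%N ->
  nth (0, 0) (rot i P) (n.+1 - i + l).-1 = nth (0, 0) P l.-1.
Proof.
move=> le_li le_iN; rewrite /rot nth_cat size_drop size_tuple.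
have -> : ((n.+1 - i + l).-1 < n.+1 - i)%N = false by lia.
have -> : ((n.+1 - i + l).-1 - (n.+1 - i) = l.-1)%N by lia.
by rewrite nth_take //; lia.
Qed.

Section RotatedHeights.
Variables (n : nat) (P : (n.+1).-tuple (int * int)) (i : nat).
Hypothesis le_iN : (i <= n.+1)%N.
Let Q := [tuple of rot i P].

Lemma height_rot_before_wrap k : (i + k <= n.+1)%N ->
  height Q k = height P (i + k) - height P i.
Proof.
move=> le_ik; rewrite /height (@big_cat_nat _ _ _ i.+1 1 (i + k).+1) //=; last lia.
rewrite addrAC subrr add0r -(add1n i) big_addn.
have -> : ((i + k).+1 - i = k.+1)%N by lia.
apply: eq_big_nat => l lek; rewrite /vstep nth_rot_before_wrap; first last.
- lia.
- lia.
by rewrite addnC.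
Qed.

(** The part of [Q] before the wrap-around is all of [P] after step [i], which climbs
    [height P n.+1 - height P i]; the first [l] steps of [P] are then added to it. *)
Lemma height_rot_after_wrap l : (l <= i)%N ->
  height Q (n.+1 - i + l) = height P n.+1 - height P i + height P l.
Proof.
move=> le_li; rewrite {1}/height.
rewrite (@big_cat_nat _ _ _ (n.+1 - i).+1 1 _) //=; last lia.
have := @height_rot_before_wrap (n.+1 - i)%N; rewrite {1}/height => ->; last lia.
rewrite subnKC //; congr (_ + _).
rewrite -(add1n (n.+1 - i)) big_addn.
have -> : ((n.+1 - i + l).+1 - (n.+1 - i) = l.+1)%N by lia.
apply: eq_big_nat => k lek.
by rewrite /vstep addnC nth_rot_after_wrap //; lia.
Qed.

(** The tie-break of [ltP_index] is what the wrap-around produces: if [height P k = height P i],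
    step [k] has height 0 in [Q] when [k > i], but height 1 when [k <= i]. *)
Lemma NPL_rot : height P n.+1 = 1 ->
  NPL Q = \sum_(1 <= k < n.+2 | ltP_index P k i) ustep P k.
Proof.
move=> hN; rewrite /NPL /NP big_filter.
have -> : iota 1 n.+1 = index_iota 1 n.+2 by rewrite /index_iota subn1.
rewrite (@big_cat_nat _ _ _ (n.+1 - i).+1 1 n.+2) //=; last lia.
(* The steps of [P] after [i] come first in [Q], so the two halves on the right are swapped. *)
rewrite [RHS](@big_cat_nat _ _ _ i.+1 1 n.+2) //= [RHS]addrC.
congr (_ + _).
- rewrite -(add1n i) big_addn.
  have -> : (n.+2 - i = (n.+1 - i).+1)%N by lia.
  rewrite big_nat_cond [RHS]big_nat_cond; apply: eq_big => k; last first.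
    move=> /andP[lek _]; rewrite /ustep nth_rot_before_wrap; first last.
    + lia.
    + lia.
    by rewrite addnC.
  apply: andb_id2l => lek; rewrite height_rot_before_wrap /ltP_index; last lia.
  by rewrite (addnC k i); lia.
- rewrite -(add1n (n.+1 - i)) big_addn.
  have -> : (n.+2 - (n.+1 - i) = i.+1)%N by lia.
  rewrite big_nat_cond [RHS]big_nat_cond; apply: eq_big => k; last first.
    move=> /andP[lek _].
    by rewrite /ustep addnC nth_rot_after_wrap //; lia.
  apply: andb_id2l => lek; rewrite addnC height_rot_after_wrap /ltP_index; last lia.
  by rewrite hN; lia.
Qed.

End RotatedHeights.

Lemma ltP_index_irr n (P : (n.+1).-tuple (int * int)) i : ltP_index P i i = false.
Proof. by rewrite /ltP_index; lia. Qed.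

Lemma ltP_index_trans n (P : (n.+1).-tuple (int * int)) : transitive (ltP_index P).
Proof. by move=> j i k; rewrite /ltP_index; lia. Qed.

Lemma ltP_index_total n (P : (n.+1).-tuple (int * int)) i j :
  [|| ltP_index P i j, i == j | ltP_index P j i].
Proof. by rewrite /ltP_index; lia. Qed.

Section Path.
Variables (n m : nat) (P : (n.+1).-tuple (int * int)).
Hypothesis hP : lattice_path m P.

Let ustep_gt0 i : (1 <= i <= n.+1)%N -> 1 <= ustep P i.
Proof. by case: hP => _ _ hu _ /hu/andP[]. Qed.

Lemma mem_PL_index a :
  (a \in PL_index P) = (1 <= a.1 <= n.+1)%N && (a.2%:Z < ustep P a.1).
Proof.
apply/allpairsPdep/idP => [[i [j [+ + ->]]]|/andP[le_a lt_a]].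
  rewrite !mem_iota /= => le_i lt_j.
  have {}le_i : (1 <= i <= n.+1)%N by lia.
  by rewrite le_i /=; have := ustep_gt0 le_i; lia.
exists a.1, a.2; rewrite !mem_iota; split; by [lia | case: (a)].
Qed.

Lemma PNPL_dotP a : a \in PL_index P ->
  PNPL (dotP P a) = \sum_(1 <= k < n.+2 | ltP_index P k a.1) ustep P k + a.2%:Z.
Proof.
rewrite mem_PL_index => /andP[le_a _]; rewrite /PNPL NPL_rot //.
  by case/andP: le_a.
by case: hP.
Qed.

(** The right-hand sum also contains the term of [a.1], which exceeds [a.2]. Taking [p] always true
    gives the bound by [m]; taking the indices below [b.1] gives monotonicity. *)
Lemma PNPL_dotP_lt_sum (p : pred nat) a : a \in PL_index P ->
  p a.1 -> (forall k, ltP_index P k a.1 -> p k) ->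
  PNPL (dotP P a) < \sum_(1 <= k < n.+2 | p k) ustep P k.
Proof.
move=> aP pa lep; rewrite PNPL_dotP //.
move: aP; rewrite mem_PL_index => /andP[le_a lt_a].
rewrite [X in _ < X]big_mkcond (bigD1_seq a.1) ?iota_uniq ?mem_index_iota //= pa.
rewrite [X in _ < X]addrC ler_ltD // big_mkcond [leRHS]big_mkcond /=.
rewrite big_nat_cond [leRHS]big_nat_cond.
apply: ler_sum => k /andP[le_k _]; case: ifP => [lt_k|_].
  by rewrite lep //; case: eqP lt_k => [->|//]; rewrite ltP_index_irr.
by do 2 case: ifP => // _; have := ustep_gt0 le_k; lia.
Qed.

Lemma PNPL_dotP_ge0_lt a : a \in PL_index P -> 0 <= PNPL (dotP P a) < m%:Z.
Proof.
move=> aP; case: (hP) => _ _ _ <-; apply/andP; split; last exact: PNPL_dotP_lt_sum.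
rewrite PNPL_dotP // addr_ge0 // big_nat_cond sumr_ge0 // => k /andP[le_k _].
by have := ustep_gt0 le_k; lia.
Qed.

Let lt_pair (a b : nat * nat) :=
  ltP_index P a.1 b.1 || ((a.1 == b.1) && (a.2 < b.2)%N).

Lemma lt_pair_total a b : [|| lt_pair a b, a == b | lt_pair b a].
Proof.
case: a b => [i j] [k l]; rewrite /lt_pair /= xpair_eqE.
by have := ltP_index_total P i k; lia.
Qed.

Let PNPL_dotP_homo a b : a \in PL_index P -> b \in PL_index P -> lt_pair a b ->
  PNPL (dotP P a) < PNPL (dotP P b).
Proof.
move=> aP bP /orP[lt_ab|/andP[/eqP eq_ab lt_ab]]; last first.
  by rewrite !PNPL_dotP // eq_ab ltrD2l ltz_nat.
rewrite (PNPL_dotP bP) ltr_wpDr // PNPL_dotP_lt_sum // => k lt_ka.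
exact: ltP_index_trans lt_ka lt_ab.
Qed.

Lemma PNPL_dotP_inj : {in PL_index P &, injective (@PNPL n \o dotP P)}.
Proof.
move=> a b aP bP /= eq_ab; case/or3P: (lt_pair_total a b) => [lt_ab|/eqP //|lt_ba].
- by have := PNPL_dotP_homo aP bP lt_ab; rewrite eq_ab ltxx.
- by have := PNPL_dotP_homo bP aP lt_ba; rewrite eq_ab ltxx.
Qed.

(** [PNPL] depends only on the pointed path and already separates the index pairs, so no two
    rotations of [P] coincide. Hence [undup] in [PL] removes nothing, and the representatives in
    [prec] are unique. *)
Lemma dotP_inj : {in PL_index P &, injective (dotP P)}.
Proof. by move=> a b aP bP eq_ab; apply: PNPL_dotP_inj => //=; rewrite eq_ab. Qed.

Lemma prec_dotP a b : a \in PL_index P -> b \in PL_index P ->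
  prec P (dotP P a) (dotP P b) = lt_pair a b.
Proof.
move=> aP bP; apply/hasP/idP => [[a' a'P /hasP[b' b'P]]|lt_ab].
  by case/and3P=> /eqP/dotP_inj-> // /eqP/dotP_inj->.
by exists a => //; apply/hasP; exists b => //; rewrite !eqxx.
Qed.

(** Strict monotonicity of [PNPL] and totality of the order on pairs give both directions. *)
Lemma preceq_PNPL :
  {in PL P &, (fun A B => (A == B) || prec P A B) =2
              (fun A B => PNPL A <= PNPL B)}.
Proof.
move=> A B; rewrite !mem_undup => /mapP[a aP ->] /mapP[b bP ->].
rewrite prec_dotP // (inj_in_eq dotP_inj) //.
case/or3P: (lt_pair_total a b) => [lt_ab|/eqP->|lt_ba].
- by rewrite lt_ab orbT ltW // PNPL_dotP_homo.
- by rewrite eqxx lexx.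
- have lt_PNPL := PNPL_dotP_homo bP aP lt_ba.
  rewrite (leNgt _ (PNPL (dotP P b))) lt_PNPL; apply/negbTE/norP; split.
    by apply: contraTneq lt_PNPL => ->; rewrite ltxx.
  by apply: contraTN lt_PNPL => /(PNPL_dotP_homo aP bP)/ltW; rewrite leNgt.
Qed.

Lemma uniq_PL_index : uniq (PL_index P).
Proof.
by apply: allpairs_uniq_dep => [|i _|[i j] [k l] _ _ /= [-> ->]]; rewrite ?iota_uniq.
Qed.

Lemma size_PL_index : size (PL_index P) = m.
Proof.
rewrite size_allpairs_dep sumnE big_map.
apply/eqP; rewrite -eqz_nat; apply/eqP; case: (hP) => _ _ _ <-.
rewrite (big_morph Posz PoszD (erefl _)).
have -> : iota 1 n.+1 = index_iota 1 n.+2 by rewrite /index_iota subn1.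
by apply: eq_big_nat => i /ustep_gt0; rewrite size_iota; lia.
Qed.

Lemma perm_PNPL_PL : perm_eq [seq PNPL A | A <- PL P] [seq Posz k | k <- iota 0 m].
Proof.
rewrite /PL undup_id; last by rewrite map_inj_in_uniq ?uniq_PL_index //; exact: dotP_inj.
rewrite -map_comp.
have uniqW : uniq (map (@PNPL n \o dotP P) (PL_index P)).
  by rewrite map_inj_in_uniq ?uniq_PL_index //; exact: PNPL_dotP_inj.
have subW : {subset map (@PNPL n \o dotP P) (PL_index P) <= map Posz (iota 0 m)}.
  move=> _ /mapP[a /PNPL_dotP_ge0_lt le_a ->] /=.
  by apply/mapP; exists `|PNPL (dotP P a)|%N; rewrite ?mem_iota; lia.
apply: uniq_perm => //; first by rewrite map_inj_uniq ?iota_uniq // => ? ? [].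
(* Pigeonhole: [m] distinct values lying among [m] candidates exhaust them. *)
by apply: (uniq_min_size uniqW subW _).2; rewrite !size_map size_iota size_PL_index.
Qed.

(** Both lists are sorted for [<=] and are permutations of each other. *)
Lemma map_PNPL_sort :
  [seq PNPL A | A <- sort (fun A B => (A == B) || prec P A B) (PL P)] =
  [seq Posz k | k <- iota 0 m].
Proof.
apply: le_sorted_eq; last first.
- by rewrite (perm_trans _ perm_PNPL_PL) // perm_map // perm_sort.
- by rewrite sorted_map (eq_sorted (e' := leq)) ?iota_sorted.
have sort_sorted : sorted (fun A B => (A == B) || prec P A B)
    (sort (fun A B => (A == B) || prec P A B) (PL P)).
  (* Totality of the sorting relation is established only on [PL P], through its comparison with
     [PNPL]. *)
  apply: (@sort_sorted_in _ [in PL P]); last exact/allP.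
  by move=> A B AP BP; rewrite !preceq_PNPL // le_total.
rewrite sorted_map -(eq_in_sorted preceq_PNPL) //.
by apply/allP=> A; rewrite mem_sort.
Qed.

End Path.

Theorem theorem3p6 (n m : nat) (hn : (0 < n)%N) (hm : (0 < m)%N)
    (hmn : (n.+1 <= m)%N) (P : (n.+1).-tuple (int * int))
    (hP : lattice_path m P) (r : nat) (hr : (1 <= r <= m)%N) :
  PNPL (Theta P r) = r%:Z - 1.
Proof.
have eqW := map_PNPL_sort hP.
have sizeW : size (sort (fun A B => (A == B) || prec P A B) (PL P)) = m.
  by have /(congr1 size) := eqW; rewrite !size_map size_iota.
(* Since [r.-1 < m], the default value of [Theta] is never reached and [PNPL] can be moved inside
   [nth]. *)
rewrite /Theta -(nth_map _ 0) ?sizeW; last by lia.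
rewrite eqW (nth_map 0%N) ?size_iota ?nth_iota; lia.
Qed.
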